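(* Let $d \ge 1$ and $t \ge 2$ be fixed integers, and let $H$ be a fixed $d$-uniform hypergraph with at least two edges such that $\operatorname{ex}_d(n, H) = O(n^{d-1})$. Then $\operatorname{ex}_{d+1}(n,K_{H,t}) = O(n^{d+1-1/t})$.
   Context: All hypergraphs are finite. A $d$-uniform hypergraph is one all of whose edges are $d$-element subsets of the vertex set (for $d=1$ the edges are singletons). A hypergraph is $H$-free if it contains no (not necessarily induced) subhypergraph isomorphic to $H$. For a $d$-uniform hypergraph $H$, $\operatorname{ex}_d(n,H)$ denotes the maximum number of edges in an $H$-free $d$-uniform hypergraph on $n$ vertices. For a $d$-uniform hypergraph $H$ and a positive integer $t$, $K_{H,t}$ is the $(d+1)$-uniform hypergraph obtained from $H$ by adding $t$ new vertices $v_1,\dots,v_t$ and replacing every edge $e \in E(H)$ with the $t$ edges $e\cup\{v_1\},\dots,e\cup\{v_t\}$. Asymptotic notation is as $n\to\infty$ with $d$, $t$, $H$ fixed; implied constants may depend on these fixed parameters. *)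

(* Defs.v *)
From mathcomp Require Import all_boot.

Set Implicit Arguments.
Unset Strict Implicit.
Unset Printing Implicit Defensive.

(* The vertex set is the whole type, so isolated vertices are allowed. *)
Record hypergraph := Hypergraph {
  vertex : finType;
  edges : {set {set vertex}}
}.

Definition uniform (d : nat) (H : hypergraph) : bool :=
  [forall e in edges H, #|e| == d].

(* An injection f of vertices carries H isomorphically onto the hypergraph
   with vertex set f(V(H)) and edges f(e), e \in E(H); H occurs in G when some
   such image is a (not necessarily induced) subhypergraph of G. *)
Definition contains (G H : hypergraph) : bool :=
  [exists f : {ffun vertex H -> vertex G},
    injectiveb f && ([set f @: (e : {set vertex H}) | e in edges H]
                       \subset edges G)].

(* The maximum over an empty family is 0 here; this does not occur when H has
   an edge, since the edgeless hypergraph is then H-free. *)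
Definition exnum (d n : nat) (H : hypergraph) : nat :=
  \max_(E : {set {set 'I_n}} |
          uniform d (Hypergraph E) && ~~ contains (Hypergraph E) H) #|E|.

Definition KHt (H : hypergraph) (t : nat) : hypergraph :=
  @Hypergraph (vertex H + 'I_t)%type
    [set inr i |: [set inl x | x in (e : {set vertex H})]
    | e in edges H, i in 'I_t].

(* Main.v *)
Require Import Defs.
From mathcomp Require Import all_boot.

Set Implicit Arguments.
Unset Strict Implicit.
Unset Printing Implicit Defensive.

(** Kővári–Sós–Turán double counting: if G is K_{H,t}-free, every t-set S of
    vertices has at most ex_d(n, H) d-sets in its common link, so
    \sum_f deg(f)^_t <= n^t ex_d(n, H) = O(n^(t+d-1)), f ranging over d-sets.
    Convexity is used in the form a <= t + x + a^_t / x^(t-1), with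
    x = n^(1-1/t). *)

Section CommonLink.

Context {T : finType}.
Implicit Types (G : {set {set T}}) (S f : {set T}) (d t : nat).

(** The clause [v \notin f] makes every edge of a common link disjoint from [S], so that the points
    of [S] can serve as the new vertices of [KHt]. *)
Definition codeg_nbr G f : {set T} := [set v | (v \notin f) && (v |: f \in G)].

Definition common_link d G S : {set {set T}} :=
  [set f : {set T} | (#|f| == d) && (S \subset codeg_nbr G f)].

Lemma common_link_uniform d G S : uniform d (Hypergraph (common_link d G S)).
Proof. by apply/forall_inP => f; rewrite inE => /andP[]. Qed.

(** Counts the pairs [(S, f)] with [S \subset codeg_nbr G f] in two ways, by [S] and by [f]. *)
Lemma sum_card_common_link d t G :
  \sum_(S : {set T} | #|S| == t) #|common_link d G S| =
  \sum_(f : {set T} | #|f| == d) 'C(#|codeg_nbr G f|, t).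
Proof.
under eq_bigr do rewrite -sum1_card.
under eq_bigr do under eq_bigl do rewrite inE.
rewrite (exchange_big_dep (fun f : {set T} => #|f| == d)) /=; last first.
  by move=> S f _ /andP[].
apply: eq_bigr => f fd; rewrite -cards_draws -[RHS]sum1_card.
by apply: eq_bigl => S; rewrite inE fd /= andbC.
Qed.

(** The map [(f, v) -> v |: f] from such pairs hits every edge [e], for instance at [(e :\ v, v)]
    for any [v] in [e]. *)
Lemma card_uniform_le_sum_codeg d G : uniform d.+1 (Hypergraph G) ->
  #|G| <= \sum_(f : {set T} | #|f| == d) #|codeg_nbr G f|.
Proof.
move=> /forall_inP uG.
pose P := [set p : {set T} * T | (#|p.1| == d) && (p.2 \in codeg_nbr G p.1)].
have -> : \sum_(f : {set T} | #|f| == d) #|codeg_nbr G f| = #|P|.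
  rewrite -[RHS]sum1_card.
  under [LHS]eq_bigr do rewrite -sum1_card.
  rewrite (pair_big_dep (fun f : {set T} => #|f| == d)
    (fun f v => v \in codeg_nbr G f)) /=.
  by apply: eq_bigl => -[f v]; rewrite !inE.
apply: leq_trans (leq_imset_card (fun p : {set T} * T => p.2 |: p.1) P).
apply/subset_leq_card/subsetP => e eG.
have /eqP ed := uG e eG.
have /card_gt0P[v ve] : 0 < #|e| by rewrite ed.
apply/imsetP; exists (e :\ v, v); last by rewrite /= setD1K.
rewrite !inE /= eqxx /= setD1K // eG andbT.
by have := cardsD1 v e; rewrite ve ed add1n => -[<-].
Qed.

(* Isolated vertices of H may be sent into S by the given copy of H; they are
   rerouted to vertices outside S and outside that copy. *)
Lemma common_link_contains d G S (H : hypergraph) :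
    2 * #|vertex H| + #|S| <= #|T| ->
    contains (Hypergraph (common_link d G S)) H ->
  contains (Hypergraph G) (KHt H #|S|).
Proof.
move=> leT /existsP[/= f /andP[/injectiveP injf /subsetP fH]].
pose C := ~: (S :|: f @: [set: vertex H]).
(* [S] and the copy of [H] cover at most [#|S| + #|vertex H|] points, which leaves room to reroute
   all of [vertex H]. *)
have leC : #|vertex H| <= #|C|.
  have := cardsC (S :|: f @: [set: vertex H]).
  rewrite -/C cardsU card_imset // cardsT => eT.
  by rewrite -(leq_add2l (#|vertex H| + #|S|)) addnAC addnn -mul2n
             (leq_trans leT) // -eT leq_add2r addnC leq_subr.
pose r v : T := enum_val (widen_ord leC (enum_rank v)).
have rC v : r v \in C by exact: enum_valP.
have rS v : r v \notin S by have := rC v; rewrite !inE negb_or => /andP[].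
have rf v w : r v != f w.
  apply: contraTneq (rC v) => ->.
  by rewrite !inE negb_or negb_and !negbK imset_f ?orbT ?inE.
pose g v := if f v \in S then r v else f v.
have gS v : g v \notin S by rewrite /g; case: ifPn.
have injg : injective g.
  move=> v w; rewrite /g; case: ifP => _; case: ifP => _.
  - by move/enum_val_inj => -[/val_inj] e; apply: enum_rank_inj.
  - by move/eqP; rewrite (negPf (rf _ _)).
  - by move/esym/eqP; rewrite (negPf (rf _ _)).
  - exact: injf.
pose h (x : vertex H + 'I_#|S|) : T :=
  match x with inl v => g v | inr i => enum_val i end.
apply/existsP; exists (finfun (h : vertex (KHt H #|S|) -> _)); apply/andP; split.
  apply/injectiveP => -[v|i] [w|j]; rewrite !ffunE /=.
  - by move/injg ->.
  - by move=> e; have := gS v; rewrite e enum_valP.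
  - by move=> e; have := gS w; rewrite -e enum_valP.
  - by move/enum_val_inj ->.
apply/subsetP => _ /imsetP[_ /imset2P[e i eH _ ->] ->].
have := fH _ (imset_f _ eH); rewrite inE => /andP[_ /subsetP Sf].
have /[!inE] /andP[_] := Sf _ (enum_valP i).
congr (_ \in G); rewrite imsetU1 ffunE /=; congr (_ |: _).
rewrite -imset_comp; apply: eq_in_imset => v ve /=; rewrite ffunE /= /g.
(* On an edge [e] nothing is rerouted: [f v \in S] would put [f v] outside [f @: e], although
   [v \in e]. *)
case: ifPn => // /Sf /[!inE] /andP[].
by rewrite imset_f.
Qed.

End CommonLink.

Lemma exnum_lt_contains d n H (E : {set {set 'I_n}}) :
  uniform d (Hypergraph E) -> exnum d n H < #|E| -> contains (Hypergraph E) H.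
Proof.
move=> uE; apply: contraTT => nE; rewrite -leqNgt.
by apply: leq_bigmax_cond; rewrite uE.
Qed.

Lemma leq_bin_expn n k : 'C(n, k) <= n ^ k.
Proof.
apply: (leq_trans (leq_pmulr _ (fact_gt0 k))); rewrite bin_ffact.
elim: k n => // k IH [|n]; rewrite ?ffact0n // ffactnS expnS leq_mul2l /=.
by case: k IH => // k IH; rewrite (leq_trans (IH n)) // leq_exp2r.
Qed.

(** For [t <= a] each factor [a, ..., a - t + 1] is at least [a - t]; for smaller [a] truncation
    makes the left side 0. *)
Lemma expn_subn_leq_ffact a t : (a - t) ^ t <= a ^_ t.
Proof.
elim: t a => // t IH [|a]; first by rewrite sub0n exp0n.
by rewrite expnS ffactnS subSS leq_mul // (leq_trans (leq_subr _ _)).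
Qed.

Lemma sum_ffact_codeg_le d n t H (G : {set {set 'I_n}}) :
    2 * #|vertex H| + t <= n -> ~~ contains (Hypergraph G) (KHt H t) ->
  \sum_(f : {set 'I_n} | #|f| == d) #|codeg_nbr G f| ^_ t
    <= t`! * (n ^ t * exnum d n H).
Proof.
move=> le_n freeG.
(* Dividing by [t!] turns falling factorials into binomials, which count the [t]-sets [S] of the
   double count. *)
under eq_bigr do rewrite -bin_ffact mulnC.
rewrite -big_distrr leq_mul2l /= -sum_card_common_link.
apply/orP; right.
apply: (@leq_trans (\sum_(S : {set 'I_n} | #|S| == t) exnum d n H)).
  apply: leq_sum => S /eqP St; rewrite leqNgt; apply: contra freeG => lt_ex.
  rewrite -St; apply: (@common_link_contains _ d); first by rewrite St card_ord.
  exact: exnum_lt_contains (common_link_uniform _ _ _) lt_ex.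
by rewrite sum_nat_const leq_mul2r -cardsE card_draws card_ord leq_bin_expn orbT.
Qed.

From mathcomp Require Import all_order all_algebra.
From mathcomp Require Import all_classical all_reals all_analysis.
Import Order.TTheory GRing.Theory Num.Theory.
Import numFieldNormedType.Exports.
Local Open Scope classical_set_scope.
Local Open Scope ring_scope.

(** Either [a - t <= x], or [(a - t) * x^(t-1) <= (a - t)^t <= a ^_ t]. This stands in for Jensen's
    inequality. *)
Lemma le_add_ffact_div (R : realFieldType) (a t : nat) (x : R) :
  (0 < t)%N -> 0 < x -> a%:R <= t%:R + x + (a ^_ t)%:R / x ^+ t.-1.
Proof.
case: t => // t _ x0 /=.
have xt : 0 < x ^+ t by rewrite exprn_gt0.
have q0 : 0 <= (a ^_ t.+1)%:R / x ^+ t by rewrite divr_ge0 ?(ltW xt).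
have le_a : a%:R <= t.+1%:R + (a - t.+1)%:R :> R.
  by rewrite -natrD ler_nat -leq_subLR.
apply: le_trans le_a _; rewrite -addrA lerD2l.
have [le_x|/ltW ge_x] := leP ((a - t.+1)%:R) x; first by rewrite ler_wpDr.
rewrite (ler_wpDl (ltW x0)) // ler_pdivlMr //.
apply: le_trans (_ : ((a - t.+1) ^ t.+1)%:R <= _).
  by rewrite natrX exprS ler_wpM2l // lerXn2r // nnegrE ?ler0n ?(ltW x0).
by rewrite ler_nat expn_subn_leq_ffact.
Qed.

(** Sums the pointwise bound over the at most [n^d] [d]-sets; [x] stays free so that the two terms
    can be balanced later. *)
Lemma exnum_KHt_le (R : realFieldType) (d n t : nat) (H : hypergraph) (x : R) :
    (0 < t)%N -> (2 * #|vertex H| + t <= n)%N -> 0 < x ->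
  (exnum d.+1 n (KHt H t))%:R <=
    n%:R ^+ d * (t%:R + x)
    + t`!%:R * (n%:R ^+ t * (exnum d n H)%:R) / x ^+ t.-1.
Proof.
move=> t0 le_n x0; rewrite /exnum.
(* The bound holds for 0 and passes to maxima, so a single [KHt H t]-free [G] remains. *)
elim/big_ind: _ => [|a b ha hb|G /andP[uG freeG]].
- by rewrite addr_ge0 ?mulr_ge0 ?invr_ge0 ?exprn_ge0 ?addr_ge0 // ltW.
- by rewrite /maxn; case: ifP.
apply: le_trans (_ : (\sum_(f : {set 'I_n} | #|f| == d) #|codeg_nbr G f|)%:R <= _).
  by rewrite ler_nat card_uniform_le_sum_codeg.
rewrite natr_sum.
apply: le_trans (ler_sum _ (fun f _ => le_add_ffact_div _ t0 x0)) _.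
rewrite big_split /= lerD //.
  rewrite sumr_const -[leLHS]mulr_natl -cardsE card_draws card_ord -natrX ler_wpM2r //.
    by rewrite addr_ge0 // ltW.
  by rewrite ler_nat leq_bin_expn.
rewrite -mulr_suml ler_wpM2r ?invr_ge0 ?exprn_ge0 ?(ltW x0) // -natr_sum.
by rewrite -natrX -!natrM ler_nat sum_ffact_codeg_le.
Qed.

Theorem mainTheorem2 (R : realType) (d t : nat) (H : hypergraph)
    (hd : (1 <= d)%N) (ht : (2 <= t)%N)
    (hunif : uniform d H) (hedges : (2 <= #|edges H|)%N)
    (hex : (fun n : nat => (exnum d n H)%:R : R^o)
             =O_\oo (fun n : nat => n%:R ^+ (d - 1) : R^o)) :
  (fun n : nat => (exnum d.+1 n (KHt H t))%:R : R^o)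
    =O_\oo (fun n : nat => n%:R `^ (d.+1%:R - t%:R^-1) : R^o).
Proof.
have t0 : (0 < t)%N by exact: ltnW.
have /eqO_exP[K K0 hK] := hex.
(* [t + 1] comes from [t + x <= (t + 1) * x], valid once [1 <= x]; [t! * K] comes from the common
   links. *)
apply/eqO_exP; exists (t%:R + 1 + t`!%:R * K).
  by rewrite !addr_gt0 // ?mulr_gt0 ?ltr0n ?fact_gt0.
near=> n.
have hn : `|(exnum d n H)%:R : R^o| <= K * `|(n%:R : R) ^+ (d - 1) : R^o|.
  by near: n.
have le_n : (2 * #|vertex H| + t <= n)%N by near: n; exact: nbhs_infty_ge.
have n_gt0 : (0 < n)%N by rewrite (leq_trans _ le_n) // addn_gt0 t0 orbT.
have n0 : 0 < n%:R :> R by rewrite ltr0n.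
pose s : R := 1 - t%:R^-1.
pose x : R := n%:R `^ s.
have x0 : 0 < x by rewrite powR_gt0.
have tR0 : t%:R != 0 :> R by rewrite pnatr_eq0 -lt0n.
have s0 : 0 <= s by rewrite subr_ge0 invf_le1 ?ler1n ?ltr0n.
have x1 : 1 <= x.
  by rewrite -(powRr0 n%:R) ler_powR // ler1n.
have nx : n%:R `^ (d.+1%:R - t%:R^-1) = n%:R ^+ d * x.
  rewrite -powR_mulrn ?ler0n // -powRD ?(gt_eqF n0) ?implybT //.
  by rewrite /s addrA -natr1.
(* x^t = n^(t-1), the balance that fixes the choice of x *)
have xt : x ^+ t.-1 * x = n%:R ^+ t.-1.
  rewrite -exprSr prednK // -powR_mulrn ?ltW // -powRrM mulrBl mul1r mulVf //.
  by rewrite -powR_mulrn ?ltW // -[in LHS](prednK t0) -natr1 addrK.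
rewrite !ger0_norm ?exprn_ge0 // in hn; rewrite !ger0_norm ?powR_ge0 //.
apply: le_trans (exnum_KHt_le _ t0 le_n x0) _.
rewrite nx mulrDl lerD //.
  rewrite mulrCA ler_wpM2l ?exprn_ge0 // mulrDl mul1r lerD2r.
  by rewrite ler_peMr.
rewrite -!mulrA ler_wpM2l //.
rewrite mulrA ler_pdivrMr ?exprn_gt0 //.
apply: le_trans (ler_wpM2l (exprn_ge0 _ (ltW n0)) hn) _.
rewrite mulrCA -!mulrA ler_wpM2l ?(ltW K0) // [x * _]mulrC xt -!exprD.
(* The powers of [n] agree: [t + (d - 1) = d + (t - 1)], where [1 <= d] and [0 < t] keep the
   subtractions exact. *)
by rewrite subn1 -{1}(prednK t0) addSnnS prednK // addnC.
Unshelve. all: by end_near.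
Qed.
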